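(* Let $d>3$ and $A,B\in PL_d$. Then $A\cdot B$ is given, up to row permutation, as follows. (I) If $A=R_m^{(d)}$ for some $1\le m\le d$, then $A\cdot B=R_m^{(d)}$. (II) If $A$ is not a row PLM, then there exists $\sigma\in S_d$ such that $A'=\sigma\ast A$ is a CPLM. For every such $\sigma$ one has $A\cdot B=\sigma^{-1}\ast(A'\cdot B)$. Moreover $B$ is a row PLM, a CPLM, a PCPLM or an IPLM, and, writing $A'=(a'_{i,j})$, $B=(b_{i,j})$, letting $A_1$ be the PLC of $A'$ and $v=(a'_{2,1},a'_{3,1},\dots,a'_{d,1})^T$, the product $A'\cdot B$ is given in these cases by: (a) If $B=R_m^{(d)}$ with $1\le m\le d$, then $(A'\cdot B)_{i,j}=a'_{i,m}$ for all $1\le i,j\le d$. (b) If $B$ is a CPLM with PLC $B_1$, $b_{1,1}=0$ and $b_{x,1}=1$, then $$A'\cdot B=\begin{pmatrix}0&0\ \cdots\ 0\\ w&A_1\cdot B_1\end{pmatrix},$$ where $w$ is the $(x-1)$-st column of $A_1$. (c) If $B$ is a leading CPLM with PLC $B_1$, then $A'\cdot B$ is a CPLM with PLC $A_1\cdot B_1$, and $(A'\cdot B)_{i,1}=a'_{i,1}$ for all $1\le i\le d$. (d) If $B$ is a PCPLM and $\tau\in S_d$ is such that $\tau\star B$ is a CPLM, then $A'\cdot B=\tau^{-1}\star\bigl(A'\cdot(\tau\star B)\bigr)$ (where $A'\cdot(\tau\star B)$ is given by (b) or (c)). (e) If $B$ is an IPLM, then $1<\zeta(B)<d$. If $B$ is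 in standard form, with associated matrix $B_2$, then $$A'\cdot B=\begin{pmatrix}a'_{1,1}&r\\ v&X(A',\zeta(B)-1)+A_1\cdot B_2\end{pmatrix},$$ where $r$ is the row of length $d-1$ whose first $\zeta(B)-1$ entries equal $a'_{1,1}$ and whose remaining entries are $0$. Otherwise there exists $\tau\in S_d$ such that $\tilde B=\tau\star B$ is in standard form, and for such $\tau$, $A'\cdot B=\tau^{-1}\star(A'\cdot\tilde B)$, where $A'\cdot\tilde B$ is given by the preceding formula with $\tilde B$ in place of $B$.
   Context: Matrices have entries in a field $k$. A $d\times d$ matrix is a Permutation-Like Matrix (PLM) if all its entries are $0$ or $1$ and each column contains exactly one entry equal to $1$; $PL_d$ is the set of all $d\times d$ PLM. Group actions: for $\sigma\in S_d$, $\sigma\ast A$ is the matrix obtained from $A$ by permuting its rows by $\sigma$: $(\sigma\ast A)_{i,j}=a_{\sigma^{-1}(i),j}$. For $\tau\in S_d$, $\tau\star A$ is obtained by permuting columns: $(\tau\star A)_{i,j}=a_{i,\tau^{-1}(j)}$. Row PLM: for $1\le m\le d$, $R_m^{(d)}$ is the $d\times d$ matrix whose $m$-th row consists of $1$s and all of whose other entries are $0$; these are the row PLM. CPLM: $A\in PL_d$ is a canonical Permutation-Like Matrix (CPLM) if $a_{1,j}=0$ for $2\le j\le d$ and the $(d-1)\times(d-1)$ submatrix $A_1=(a_{i,j})_{2\le i,j\le d}$ lies in $PL_{d-1}$; $A_1$ is called the Permutation-Like Component (PLC) of $A$. A CPLM is leading if $a_{1,1}=1$. PCPLM: $A\in PL_d$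 is a pre-canonical Permutation-Like Matrix (PCPLM) if there is $\tau\in S_d$ with $\tau\star A$ a CPLM. IPLM: $A\in PL_d$ is an irregular Permutation-Like Matrix (IPLM) if it is not a row PLM, a CPLM, or a PCPLM. $\zeta(B)$ is the number of nonzero entries in the first row of $B$. For $B\in PL_d$ with $1<\zeta(B)<d$, say that $B$ is in standard form if the $1$s of its first row occupy the first $\zeta(B)$ columns, i.e. $B=\begin{pmatrix}1\ \cdots\ 1&0\ \cdots\ 0\\ \mathbf 0&B_1\end{pmatrix}$ with $\mathbf 0$ the $(d-1)\times\zeta(B)$ zero matrix and $B_1$ of size $(d-1)\times(d-\zeta(B))$; the associated matrix $B_2$ is the $(d-1)\times(d-1)$ matrix obtained by augmenting $B_1$ on the left by the $(d-1)\times(\zeta(B)-1)$ zero matrix. For a $d\times d$ matrix $A$ and $0\le n\le d-1$, $X(A,n)$ is the $(d-1)\times(d-1)$ matrix whose $i$-th row has its first $n$ entries equal to $a_{i+1,1}$ and its remaining entries equal to $0$. *)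

(* Defs.v *)
From HB Require Import structures.
From mathcomp Require Import all_boot all_order all_algebra all_fingroup.

Set Implicit Arguments.
Unset Strict Implicit.
Unset Printing Implicit Defensive.

Import GRing.Theory.
Local Open Scope ring_scope.

(* Sizes: where a (d-1) x (d-1) submatrix is involved, d is written 1 + n, so
   that drsubmx, dlsubmx and block_mx apply to the split "first index / rest".
   Indices count from 0: ord0 is the first row or column, and rshift 1 i is the
   row or column i of that submatrix, seen in the whole matrix.                *)

Section AnySize.
Variables (k : fieldType) (d : nat).
Implicit Types A : 'M[k]_d.

Definition PL : {pred 'M[k]_d} := fun A =>
  [forall i, forall j, (A i j == 0) || (A i j == 1)]
  && [forall j, #|[pred i | A i j == 1]| == 1%N].

(* row_perm s A has entries A (s i) j, whence the inverses:
   (row_act s A) i j = A (s^-1 i) j and (col_act t A) i j = A i (t^-1 j).      *)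
Definition row_act (s : 'S_d) A : 'M[k]_d := row_perm s^-1%g A.
Definition col_act (t : 'S_d) A : 'M[k]_d := col_perm t^-1%g A.

Definition row_PLM (m : 'I_d) : 'M[k]_d := \matrix_(i, j) (i == m)%:R.

Definition is_row_PLM A : bool := [exists m, A == row_PLM m].

End AnySize.
Arguments PL k d : clear implicits.

Section PositiveSize.
Variables (k : fieldType) (n : nat).
Implicit Types A B : 'M[k]_(1 + n).

Definition PLC A : 'M[k]_n := drsubmx A.

Definition is_CPLM A : bool :=
  [&& A \in PL k (1 + n),
      [forall j, (j != ord0) ==> (A ord0 j == 0)]
    & PLC A \in PL k n].

Definition is_leading_CPLM A : bool := is_CPLM A && (A ord0 ord0 == 1).

Definition is_PCPLM A : bool :=
  (A \in PL k (1 + n)) && [exists t : 'S_(1 + n), is_CPLM (col_act t A)].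

Definition is_IPLM A : bool :=
  [&& A \in PL k (1 + n), ~~ is_row_PLM A, ~~ is_CPLM A & ~~ is_PCPLM A].

Definition zeta B : nat := #|[pred j | B ord0 j != 0]|.

Definition is_standard B : bool :=
  [&& B \in PL k (1 + n), (1 < zeta B < 1 + n)%N
    & [forall j : 'I_(1 + n), (B ord0 j == 1) == (j < zeta B)%N]].

(* The matrix B_2 = (0 | B_1), where B_1 consists of the last d - zeta B columns
   of B without their first entries.  Prefixing zeta B - 1 zero columns puts
   column j of B (j >= zeta B, counting from 0) at place j - 1 of B_2.         *)
Definition assoc_mx B : 'M[k]_n :=
  \matrix_(i, j) if (j < (zeta B).-1)%N then 0 else B (rshift 1 i) (rshift 1 j).

Definition Xmx A (m : nat) : 'M[k]_n :=
  \matrix_(i, j) if (j < m)%N then A (rshift 1 i) ord0 else 0.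

(* The product A *m B for B a CPLM with zero upper left entry.  If x is the row
   of the 1 in the first column of B, then x = rshift 1 y, and column y of PLC A
   is its (x - 1)-st column when x and columns are counted from 1.             *)
Definition prod_nonleading A B : Prop :=
  forall x : 'I_(1 + n), B x ord0 = 1 ->
  exists2 y : 'I_n, x = rshift 1 y &
    A *m B = block_mx 0                0
                      (col y (PLC A)) (PLC A *m PLC B).

Definition prod_leading A B : Prop :=
  [/\ is_CPLM (A *m B),
      PLC (A *m B) = PLC A *m PLC B
    & forall i, (A *m B) i ord0 = A i ord0].

Definition prod_standard A B : Prop :=
  A *m B =
    block_mx
      (const_mx (A ord0 ord0) : 'M_1)
      (\row_(j < n) if (j < (zeta B).-1)%N then A ord0 ord0 else 0)
      (\col_(i < n) A (rshift 1 i) ord0)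
      (Xmx A (zeta B).-1 + PLC A *m assoc_mx B).

End PositiveSize.

(* Main.v *)
(* A PLM is the matrix of a self-map f of the index set, with the 1 of column j
   in row f j, so right multiplication by it selects the columns f j of the other
   factor.  It is a CPLM iff f j is the first index for no j but possibly the
   first, and counting shows that the values of f at the other j miss some row,
   which a transposition moves to the top. *)
Require Import Defs.
From HB Require Import structures.
From mathcomp Require Import all_boot all_order all_algebra all_fingroup.

Set Implicit Arguments.
Unset Strict Implicit.
Unset Printing Implicit Defensive.

Import GRing.Theory.
Local Open Scope ring_scope.

(** * Counting index sets and matching them by a permutation *)

Lemma card_ltn_ord d m : (m <= d)%N -> #|[pred j : 'I_d | (j < m)%N]| = m.
Proof. by move=> md; rewrite -sum1_card -(big_ord_widen d (fun=> 1%N) md) sum1_card card_ord. Qed.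

(** Listed as boolean tuples, [P] and [Q] contain [true] equally often, hence by complement also
    [false], so one tuple is a rearrangement of the other. This later brings the ones of a first row
    to the front. *)
Lemma perm_of_card d (P Q : pred 'I_d) : #|P| = #|Q| ->
  exists s : 'S_d, forall i, P (s i) = Q i.
Proof.
move=> cPQ; pose u := [tuple Q i | i < d]; pose w := [tuple P i | i < d].
have cE b (R : pred 'I_d) : count_mem b [tuple R i | i < d] = if b then #|R| else #|predC R|.
  rewrite count_map -size_filter val_ord_tuple enumT; case: b; rewrite cardE /enum_mem;
  by congr size; apply: eq_filter => i; rewrite /= ?inE /in_mem /=; case: (R i).
have /tuple_permP [p up] : perm_eq u w.
  apply/allP => b _; change (count_mem b u == count_mem b w).
  rewrite !cE; case: b; first by rewrite cPQ.
  by rewrite -(eqn_add2l #|P|) cardC cPQ cardC.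
exists p => i; have /val_inj/(congr1 (fun t : d.-tuple bool => tnth t i)) := up.
by rewrite !tnth_mktuple.
Qed.

(** * PLM as matrices of self-maps, and the two permutation actions *)

Section FunMatrix.
Variable k : fieldType.

Definition fun_mx d (f : 'I_d -> 'I_d) : 'M[k]_d := \matrix_(i, j) (i == f j)%:R.

Lemma eq_natb1 (b : bool) : (b%:R == 1 :> k) = b.
Proof. by case: b; rewrite ?eqxx // eq_sym oner_eq0. Qed.

Lemma eq_natb0 (b : bool) : (b%:R == 0 :> k) = ~~ b.
Proof. by case: b; rewrite ?eqxx // oner_eq0. Qed.

Lemma PLP d (A : 'M[k]_d) :
  reflect (exists f : 'I_d -> 'I_d, A = fun_mx f) (A \in PL k d).
Proof.
apply: (iffP andP) => [[/forallP A01 /forallP A1] | [f ->]].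
  have /fin_all_exists [f fP] j : exists m, forall i, (A i j == 1) = (i == m).
    have /card1P [m mP] : #|[pred i | A i j == 1]| == 1%N := A1 j.
    by exists m => i; have := mP i; rewrite !inE.
  exists f; apply/matrixP => i j; rewrite mxE -fP.
  by have /forallP/(_ j)/orP := A01 i => -[] /eqP ->; rewrite ?eqxx // eq_sym oner_eq0.
split; apply/forallP => i.
  by apply/forallP => j; rewrite mxE eq_natb0 eq_natb1 orNb.
by rewrite -(card1 (f i)); apply/eqP/eq_card => j; rewrite !inE mxE eq_natb1.
Qed.

Lemma mulmx_fun m d (A : 'M[k]_(m, d)) (f : 'I_d -> 'I_d) i j :
  (A *m fun_mx f) i j = A i (f j).
Proof.
rewrite mxE (bigD1 (f j)) //= mxE eqxx mulr1 big1 ?addr0 // => l lf.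
by rewrite mxE (negPf lf) mulr0.
Qed.

Lemma row_act_fun d (s : 'S_d) (f : 'I_d -> 'I_d) :
  row_act s (fun_mx f) = fun_mx (s \o f).
Proof.
apply/matrixP => i j; rewrite !mxE /=; congr (_%:R).
by rewrite -(inj_eq (@perm_inj _ s)) permKV.
Qed.

Lemma col_act_fun d (t : 'S_d) (f : 'I_d -> 'I_d) :
  col_act t (fun_mx f) = fun_mx (f \o t^-1%g).
Proof. by apply/matrixP => i j; rewrite !mxE. Qed.

Lemma col_act_PL d (t : 'S_d) (B : 'M[k]_d) : B \in PL k d -> col_act t B \in PL k d.
Proof. by move=> /PLP [f ->]; apply/PLP; exists (f \o t^-1%g); rewrite col_act_fun. Qed.

Lemma row_actK d (s : 'S_d) (A : 'M[k]_d) : row_act s^-1 (row_act s A) = A.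
Proof. by apply/matrixP => i j; rewrite !mxE invgK permK. Qed.

Lemma col_actK d (t : 'S_d) (A : 'M[k]_d) : col_act t^-1 (col_act t A) = A.
Proof. by apply/matrixP => i j; rewrite !mxE invgK permK. Qed.

Lemma row_act_mulmx d (s : 'S_d) (A B : 'M[k]_d) : row_act s A *m B = row_act s (A *m B).
Proof. by apply/matrixP => i j; rewrite !mxE; apply: eq_bigr => l _; rewrite mxE. Qed.

Lemma col_act_mulmx d (t : 'S_d) (A B : 'M[k]_d) : A *m col_act t B = col_act t (A *m B).
Proof. by apply/matrixP => i j; rewrite !mxE; apply: eq_bigr => l _; rewrite mxE. Qed.

Lemma row_PLM_mul d (m : 'I_d) (B : 'M[k]_d) : B \in PL k d -> row_PLM k m *m B = row_PLM k m.
Proof. by move=> /PLP [f ->]; apply/matrixP => i j; rewrite mulmx_fun !mxE. Qed.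

Lemma mul_row_PLM d (m : 'I_d) (A : 'M[k]_d) i j : (A *m row_PLM k m) i j = A i m.
Proof. exact: mulmx_fun. Qed.

End FunMatrix.

(** * Canonical PLM in terms of self-maps *)

Section Canonical.
Variables (k : fieldType) (n : nat).
Implicit Types (A B : 'M[k]_(1 + n)) (f : 'I_(1 + n) -> 'I_(1 + n)).

(** The block splitting of an index, with [ord0] in place of [lshift] so that it matches the
    definitions of CPLM and of standard form. *)
Lemma ord0_or_rshift (i : 'I_(1 + n)) : i = ord0 \/ exists j : 'I_n, i = rshift 1 j.
Proof.
case: (split_ordP i) => [j -> | j ->]; last by right; exists j.
by left; rewrite (ord1 j); apply: val_inj.
Qed.

Lemma lshift1_ord0 : lshift n (ord0 : 'I_1) = ord0 :> 'I_(1 + n).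
Proof. exact: val_inj. Qed.

Lemma rshift1_neq0 (j : 'I_n) : rshift 1 j != ord0 :> 'I_(1 + n).
Proof. by []. Qed.

Lemma CPLM_fun f :
  is_CPLM (fun_mx k f) = [forall j, (j != ord0) ==> (f j != ord0)].
Proof.
apply/and3P/forallP => [[_ /forallP f0 _] j | f0].
  by apply/implyP => /(implyP (f0 j)); rewrite mxE eq_natb0 eq_sym.
split; first by apply/PLP; exists f.
  by apply/forallP => j; rewrite mxE eq_natb0 (eq_sym ord0); exact: f0.
(* Away from the first index [f] takes values in the range of [rshift 1], so it induces a self-map
   [g] of the remaining indices; the matrix of [g] is the PLC. *)
have /fin_all_exists [g gP] (j : 'I_n) : exists l : 'I_n, f (rshift 1 j) = rshift 1 l.
  case: (ord0_or_rshift (f (rshift 1 j))) => // fj0.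
  by have /implyP/(_ (rshift1_neq0 j)) := f0 (rshift 1 j); rewrite fj0.
apply/PLP; exists g; apply/matrixP => i j.
by rewrite !mxE gP (inj_eq (@rshift_inj _ _)).
Qed.

Lemma CPLM_row0 A (j : 'I_n) : is_CPLM A -> A ord0 (rshift 1 j) = 0.
Proof. by case/and3P=> _ /forallP/(_ (rshift 1 j))/eqP. Qed.

Lemma CPLM_row_act A : A \in PL k (1 + n) -> exists s : 'S_(1 + n), is_CPLM (row_act s A).
Proof.
move=> /PLP [f ->].
have [r rP] : exists r, forall j : 'I_n, f (rshift 1 j) != r.
  have : ~~ ([set: 'I_(1 + n)] \subset [set f (rshift 1 j) | j : 'I_n]).
    apply/negP => /subset_leq_card; rewrite cardsT card_ord leqNgt ltnS.
    by rewrite (leq_trans (leq_imset_card _ _)) ?card_ord.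
  case/subsetPn => r _ rN; exists r => j.
  by apply: contraNneq rN => <-; apply: imset_f.
exists (tperm r ord0); rewrite row_act_fun CPLM_fun.
apply/forallP => i; apply/implyP; case: (ord0_or_rshift i) => [-> // | [j -> _]] /=.
(* Reading [ord0] as the image of [r] under the transposition reduces the goal, by injectivity, to
   [r] being a missed value. *)
by rewrite -[X in _ != X](tpermL r ord0) (inj_eq perm_inj).
Qed.

(** * Products of a CPLM with a CPLM *)

Lemma CPLM_mulmx_row0 A f (j : 'I_(1 + n)) :
  is_CPLM A -> f j != ord0 -> (A *m fun_mx k f) ord0 j = 0.
Proof.
move=> cA; rewrite mulmx_fun; case: (ord0_or_rshift (f j)) => [-> // | [l -> _]].
exact: CPLM_row0.
Qed.

(** The hypothesis kills the term of the first inner index, and the other terms form the product of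
    the lower right blocks. It concerns a single column because, for [B] in standard form, only the
    later columns start with 0. *)
Lemma drsub_mulmx_row0 A B (i j : 'I_n) : B ord0 (rshift 1 j) = 0 ->
  (A *m B) (rshift 1 i) (rshift 1 j) = (PLC A *m PLC B) i j.
Proof.
move=> B0; rewrite !mxE big_split_ord big_ord1 /=.
rewrite lshift1_ord0 B0 mulr0 add0r.
by apply: eq_bigr => l _; rewrite !mxE.
Qed.

(** The map of [B] never takes the value [ord0]: at the first index since [B ord0 ord0 = 0],
    elsewhere since [B] is a CPLM. So every column of the product is a column of [A] other than the
    first, and starts with 0. *)
Lemma prod_nonleadingP A B : is_CPLM A -> is_CPLM B -> B ord0 ord0 = 0 -> prod_nonleading A B.
Proof.
move=> cA cB B00 x Bx; have /and3P [/PLP [f fP] _ _] := cB.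
have f0 : f ord0 = x.
  by apply/esym/eqP; move/eqP: Bx; rewrite fP mxE eq_natb1.
have [x0 | [y xy]] := ord0_or_rshift x.
  by move/eqP: Bx; rewrite x0 B00 eq_sym oner_eq0.
exists y => //; apply/matrixP => i j.
case: (split_ordP i) => i' ->; case: (split_ordP j) => j' ->;
  rewrite ?block_mxEul ?block_mxEur ?block_mxEdl ?block_mxEdr.
- rewrite !ord1 [RHS]mxE lshift1_ord0.
  by rewrite fP CPLM_mulmx_row0 // f0 xy.
- rewrite ord1 [RHS]mxE lshift1_ord0.
  rewrite fP CPLM_mulmx_row0 //.
  by move: cB; rewrite fP CPLM_fun => /forallP/(_ (rshift 1 j'))/implyP->.
- rewrite ord1 fP mulmx_fun lshift1_ord0.
  by rewrite f0 xy !mxE.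
- by rewrite drsub_mulmx_row0 // CPLM_row0.
Qed.

(** Self-maps that send no later index to the first one are closed under composition. Leading means
    that the map of [B] fixes [ord0], which preserves the first column of [A]. *)
Lemma prod_leadingP A B : is_CPLM A -> is_leading_CPLM B -> prod_leading A B.
Proof.
move=> cA /andP [cB B00].
have /and3P [/PLP [f fP] _ _] := cB; have /and3P [/PLP [g gP] _ _] := cA.
split.
- have -> : A *m B = fun_mx k (g \o f).
    by rewrite gP fP; apply/matrixP => i j; rewrite mulmx_fun !mxE.
  move: cA cB; rewrite gP fP !CPLM_fun => /forallP g0 /forallP f0.
  by apply/forallP => j; apply/implyP => /(implyP (f0 j)) /(implyP (g0 _)).
- by apply/matrixP => i j; rewrite -drsub_mulmx_row0 ?CPLM_row0 // /PLC !mxE.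
- move=> i; rewrite fP mulmx_fun; congr (A _ _).
  by apply/esym/eqP; move: B00; rewrite fP mxE eq_natb1.
Qed.

Lemma CPLM_leadingVnonleading B : is_CPLM B -> B ord0 ord0 = 0 \/ is_leading_CPLM B.
Proof.
move=> cB; rewrite /is_leading_CPLM cB; have /and3P [/andP [/forallP B01 _] _ _] := cB.
by have /forallP/(_ ord0)/orP := B01 ord0 => -[/eqP | ]; [left | right].
Qed.

(** * The first row count [zeta], standard form and irregular PLM *)

Lemma zeta_fun f : zeta (fun_mx k f) = #|[pred j | f j == ord0]|.
Proof. by apply: eq_card => j; rewrite !inE mxE eq_natb0 negbK eq_sym. Qed.

Lemma standardE f : is_standard (fun_mx k f) ->
  (1 < zeta (fun_mx k f))%N /\ forall j, (f j == ord0) = (j < zeta (fun_mx k f))%N.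
Proof.
case/and3P=> _ /andP [z1 _] /forallP fP; split=> // j.
by have /eqP <- := fP j; rewrite mxE eq_natb1 eq_sym.
Qed.

(** Each of the first [zeta B] columns of the product copies the first column of [A]: one copy fills
    the left blocks, the [zeta B - 1] others lie in the right blocks. The later columns select
    columns of [A] other than the first. *)
Lemma prod_standardP A B : is_CPLM A -> is_standard B -> prod_standard A B.
Proof.
move=> cA sB; have /and3P [/PLP [f fP] _ _] := sB.
move: sB; rewrite /prod_standard fP => /standardE [].
set z := zeta _ => z1 fz.
(* Column [j] of the right blocks is column [j + 1] of the whole matrix, whence the predecessor. *)
have fz' (j : 'I_n) : (f (rshift 1 j) == ord0) = (j < z.-1)%N.
  by rewrite fz /= add1n -ltn_predRL.
have f0 : f ord0 = ord0 by apply/eqP; rewrite fz (ltn_trans _ z1).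
apply/matrixP => i j.
case: (split_ordP i) => i' ->; case: (split_ordP j) => j' ->;
  rewrite ?block_mxEul ?block_mxEur ?block_mxEdl ?block_mxEdr ?ord1 ?lshift1_ord0.
- by rewrite mulmx_fun f0 mxE.
- rewrite [RHS]mxE -fz'; case: ifPn => [/eqP fj | fj]; last exact: CPLM_mulmx_row0.
  by rewrite mulmx_fun fj.
- by rewrite mulmx_fun f0 mxE.
(* The two summands live in disjoint columns: before [z.-1] the column of [assoc_mx] is zero; from
   there on that of [Xmx] is zero and [assoc_mx] agrees with [PLC]. *)
- rewrite [RHS]mxE [Xmx _ _ _ _]mxE -fz'; case: ifPn => [/eqP fj | fj].
    rewrite mulmx_fun fj mxE big1 ?addr0 // => l _.
    by rewrite [assoc_mx _ _ _]mxE -/z -fz' fj eqxx mulr0.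
  rewrite add0r drsub_mulmx_row0; last first.
    by apply/eqP; rewrite mxE eq_natb0 eq_sym.
  rewrite !mxE; apply: eq_bigr => l _; congr (_ * _).
  by rewrite [RHS]mxE -/z -fz' (negPf fj) /PLC !mxE.
Qed.

(** A first row full of ones makes the map constant, so [B] would be a row PLM. With at most one 1
    there, exchanging its column with the first would give a CPLM, so [B] would be a PCPLM. *)
Lemma IPLM_zeta B : is_IPLM B -> (1 < zeta B < 1 + n)%N.
Proof.
case/and4P=> /PLP [f fP]; rewrite {B}fP => nrow nC nPC; rewrite zeta_fun.
set P := [pred j | _]; apply/andP; split; last first.
  rewrite ltn_neqAle -[X in (_ <= X)%N]card_ord max_card andbT.
  apply: contraNneq nrow => cP; apply/existsP; exists ord0.
  apply/eqP/matrixP => i j; rewrite !mxE.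
  have PT : P =i predT by apply/subset_cardP; rewrite ?cP ?card_ord ?subset_predT.
  by have := PT j; rewrite !inE => /eqP ->.
rewrite ltnNge; apply/negP => P1.
move: nPC; rewrite /is_PCPLM negb_and => /orP [/PLP [] | /existsP []]; first by exists f.
(* If the first row is zero, any [j0] will do and [ord0] is taken; otherwise a second index with
   value [ord0] would contradict [P1]. *)
have [j0 j0P] : exists j0, forall j, f j == ord0 -> j = j0.
  have [j1 j1P | noj] := pickP P; last by exists ord0 => j; have := noj j; rewrite inE => ->.
  exists j1 => j jP; apply/eqP; apply: contraTT P1 => jj1.
  by rewrite -ltnNge; apply/card_gt1P; exists j, j1; rewrite !inE.
exists (tperm j0 ord0); rewrite col_act_fun CPLM_fun; apply/forallP => j; apply/implyP.
by apply: contraNneq => /= /eqP /j0P; rewrite tpermV => /(canRL (tpermK _ _)) ->; rewrite tpermL.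
Qed.

Lemma zeta_col_act (t : 'S_(1 + n)) B : zeta (col_act t B) = zeta B.
Proof.
rewrite /zeta -(card_image (@perm_inj _ t^-1%g)); apply: eq_card => j.
by rewrite -[j in LHS](permK t) mem_image ?inE ?mxE ?permK //; exact: perm_inj.
Qed.

Lemma exists_standard B : B \in PL k (1 + n) -> (1 < zeta B < 1 + n)%N ->
  exists t : 'S_(1 + n), is_standard (col_act t B).
Proof.
move=> PB zB; have /andP [_ /ltnW zn] := zB.
have [p pP] : exists p : 'S_(1 + n), forall j, (B ord0 (p j) != 0) = (j < zeta B)%N.
  by apply: (@perm_of_card _ [pred j | B ord0 j != 0] (fun j => (j < zeta B)%N));
    rewrite card_ltn_ord.
(* [p j] is the column of [B] to be put at place [j], and [col_act t] puts column [t^-1 j] there. *)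
exists p^-1%g; apply/and3P; split; rewrite ?col_act_PL ?zeta_col_act //.
apply/forallP => j; rewrite mxE invgK -pP; have /PLP [f ->] := PB.
by rewrite mxE eq_natb0 eq_natb1 negbK.
Qed.

Lemma PL_cases B : B \in PL k (1 + n) ->
  [\/ is_row_PLM B, is_CPLM B, is_PCPLM B | is_IPLM B].
Proof.
move=> PB; rewrite /is_IPLM PB /=.
case: (is_row_PLM B); first by constructor 1.
case: (is_CPLM B); first by constructor 2.
by case: (is_PCPLM B); [constructor 3 | constructor 4].
Qed.

End Canonical.

(** * The product of two PLM, case by case *)

Theorem theorem3p20 (k : fieldType) (n : nat) (hd : (3 < 1 + n)%N)
    (A B : 'M[k]_(1 + n))
    (hA : A \in PL k (1 + n)) (hB : B \in PL k (1 + n)) :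
  (* (I) *)
  (forall m : 'I_(1 + n), A = row_PLM k m -> A *m B = row_PLM k m)
  /\
  (* (II) *)
  (~~ is_row_PLM A ->
    (exists sigma : 'S_(1 + n), is_CPLM (row_act sigma A))
    /\
    (forall sigma : 'S_(1 + n), is_CPLM (row_act sigma A) ->
      let A' := row_act sigma A in
      A *m B = row_act sigma^-1%g (A' *m B)
      /\ [\/ is_row_PLM B, is_CPLM B, is_PCPLM B | is_IPLM B]
      /\ (* (a) *)
         (forall m : 'I_(1 + n), B = row_PLM k m ->
            forall i j : 'I_(1 + n), (A' *m B) i j = A' i m)
      /\ (* (b) *)
         (is_CPLM B -> B ord0 ord0 = 0 -> prod_nonleading A' B)
      /\ (* (c) *)
         (is_leading_CPLM B -> prod_leading A' B)
      /\ (* (d) *)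
         (is_PCPLM B -> forall tau : 'S_(1 + n), is_CPLM (col_act tau B) ->
            let B' := col_act tau B in
            A' *m B = col_act tau^-1%g (A' *m B')
            /\ ((B' ord0 ord0 = 0 /\ prod_nonleading A' B')
                \/ (is_leading_CPLM B' /\ prod_leading A' B')))
      /\ (* (e) *)
         (is_IPLM B ->
            (1 < zeta B < 1 + n)%N
            /\ (is_standard B -> prod_standard A' B)
            /\ (~~ is_standard B ->
                  (exists tau : 'S_(1 + n), is_standard (col_act tau B))
                  /\ (forall tau : 'S_(1 + n), is_standard (col_act tau B) ->
                        let B' := col_act tau B in
                        A' *m B = col_act tau^-1%g (A' *m B')
                        /\ prod_standard A' B'))))).
Proof.
split=> [m -> | _]; first exact: row_PLM_mul.
split; first exact: CPLM_row_act.
move=> s cA A'; split; first by rewrite row_act_mulmx row_actK.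
split; first exact: PL_cases.
split=> [m -> i j | ]; first exact: mul_row_PLM.
split; first exact: prod_nonleadingP.
split; first exact: prod_leadingP.
split=> [_ t cB B' | iB].
  split; first by rewrite col_act_mulmx col_actK.
  (* The upper left entry of the CPLM [B'] is 0 or 1, which decides between the two product
     formulas. *)
  have [B00 | lB] := CPLM_leadingVnonleading cB; [left | right]; split=> //.
    exact: prod_nonleadingP.
  exact: prod_leadingP.
split; first exact: IPLM_zeta.
split; first exact: prod_standardP.
move=> _; split; first exact: exists_standard (IPLM_zeta iB).
move=> t sB B'; split; first by rewrite col_act_mulmx col_actK.
exact: prod_standardP.
Qed.
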